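(* For every positive integer $n$ and every $U\subseteq[n]$, the lattice $\mathsf{A}_U(n)$ join-fits within the permutohedron $\mathsf{P}(n)$. Consequently, $\mathsf{A}_U(n)$ is a lattice-theoretical retract of $\mathsf{P}(n)$.
   Context: Notation: $[n]=\{1,\dots,n\}$ and $\mathcal{I}_n=\{(i,j)\in[n]\times[n] : i<j\}$. Permutohedra: a subset $\boldsymbol x\subseteq\mathcal{I}_n$ is closed if it is transitive as a binary relation, and clopen if both $\boldsymbol x$ and $\mathcal{I}_n\setminus\boldsymbol x$ are closed. The permutohedron $\mathsf{P}(n)$ is the set of all clopen subsets of $\mathcal{I}_n$, ordered by inclusion; it is a lattice. For $U\subseteq[n]$, $\mathsf{A}_U(n)$ is the set of all subsets $\boldsymbol{a}\subseteq\mathcal{I}_n$ that are transitive as binary relations and such that, whenever $1\le i<j<k\le n$ and $(i,k)\in\boldsymbol{a}$: $(i,j)\in\boldsymbol{a}$ if $j\in U$, and $(j,k)\in\boldsymbol{a}$ if $j\notin U$. It is ordered by inclusion. (Every member of $\mathsf{A}_U(n)$ is clopen, so $\mathsf{A}_U(n)\subseteq\mathsf{P}(n)$.) For a finite lattice $L$, $\mathrm{Ji}(L)$ is the set of join-irreducible elements of $L$ (nonzero elements $p$ such that $p=\bigvee X$ implies $p\in X$ for every finite nonempty $X\subseteq L$), and $q_*$ is the unique lower cover of $q\in\mathrm{Ji}(L)$. The join-dependency relation $\boldsymbol{D}_L$ is defined by: $a\,\boldsymbol{D}_L\,q$ iff $q\in\mathrm{Ji}(L)$, $a\ne q$, and there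 exists $x\in L$ with $a\le q\vee x$ and $a\nleq q_*\vee x$. A $(\vee,0,1)$-subsemilattice $K$ of a finite lattice $L$ join-fits within $L$ if for all $(p,q)\in\mathrm{Ji}(K)\times\mathrm{Ji}(L)$, $p\,\boldsymbol{D}_L\,q$ implies $q\in K$. A lattice $K$ is a lattice-theoretical retract of a lattice $L$ if there are lattice homomorphisms $\varepsilon\colon K\to L$ and $\pi\colon L\to K$ with $\pi\circ\varepsilon=\mathrm{id}_K$. *)

(* Defs.v *)
From HB Require Import structures.
From mathcomp Require Import all_boot all_order.
Set Implicit Arguments.
Unset Strict Implicit.
Unset Printing Implicit Defensive.
Import Order.TTheory.
Local Open Scope order_scope.

Section JoinFit.
Context {d : Order.disp_t} {L : finTBLatticeType d}.
Implicit Types (K : {pred L}) (p q r x : L).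

(* K is meant to be closed under binary joins, so that a join of elements of K
   is the same computed in K or in L; the join-irreducible elements of L itself
   are those of [Ji predT]. *)
Definition Ji K : {pred L} :=
  [pred p in K | (p != \bot) &&
     [forall X : {set L}, (X != set0) ==> (X \subset K) ==>
        (p == \join_(x in X) x) ==> (p \in X)]].

Definition lower_cover r q := (r < q) && [forall x, ~~ ((r < x) && (x < q))].

(* Only meaningful for q in [Ji predT], see [Ji_lower_cover]. *)
Definition lower_star q : L := odflt \bot [pick r | lower_cover r q].

Lemma Ji_lower_cover q :
  q \in Ji predT -> forall r, lower_cover r q = (r == lower_star q).
Proof.
case/andP=> _ /andP[q0 /forallP qP].
pose s : L := \join_(x in [set x | x < q]) x.
have s_ub x : x < q -> x <= s.
  by move=> xq; apply: joins_sup; rewrite inE.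
have sq : s < q.
  rewrite lt_neqAle; apply/andP; split; last first.
    by apply/joinsP => x; rewrite inE => /ltW.
  apply/negP=> /eqP sq; have := qP [set x | x < q]; rewrite -/s sq eqxx inE ltxx.
  have -> : [set x | x < q] != set0.
    by apply/set0Pn; exists \bot; rewrite inE lt0x.
  suff -> : [set x | x < q] \subset predT by [].
  by apply/subsetP.
have coverP r : lower_cover r q = (r == s).
  apply/andP/eqP => [[rq /forallP rP]|->].
    by have:= s_ub _ rq; rewrite le_eqVlt => /predU1P[//|rs]; move: (rP s); rewrite rs sq.
  split=> //; apply/forallP => x; apply/negP => /andP[sx /s_ub xs].
  by have:= lt_le_trans sx xs; rewrite ltxx.
move=> r; rewrite coverP /lower_star; case: pickP => [t|/(_ s)] /=.
  by rewrite coverP => /eqP->.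
by rewrite coverP eqxx.
Qed.

Definition join_dep p q : Prop :=
  [/\ q \in Ji predT, p != q &
      exists x, p <= q `|` x /\ ~~ (p <= lower_star q `|` x)].

Definition join01_subsemilattice K : Prop :=
  [/\ \bot \in K, \top \in K & {in K &, forall x y, x `|` y \in K}].

Definition join_fits K : Prop :=
  join01_subsemilattice K /\
  forall p q, p \in Ji K -> q \in Ji predT -> join_dep p q -> q \in K.

End JoinFit.

Definition lattice_retract d (K : latticeType d) d' (L : latticeType d') : Prop :=
  exists (eps : {lmorphism K -> L}) (pi : {lmorphism L -> K}), cancel eps pi.

(* The indices 1, ..., n are represented by the ordinals 0, ..., n - 1. *)
Section Relations.
Variable n : nat.
Implicit Types (i j k : 'I_n) (a b : {set 'I_n * 'I_n}) (U : {set 'I_n}).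

Definition incr_pairs : {set 'I_n * 'I_n} := [set ij : 'I_n * 'I_n | (ij.1 < ij.2)%N].

Definition trans_rel a : bool :=
  [forall i : 'I_n, forall j : 'I_n, forall k : 'I_n,
     ((i, j) \in a) ==> ((j, k) \in a) ==> ((i, k) \in a)].

Definition closed_rel a := (a \subset incr_pairs) && trans_rel a.

Definition clopen_rel a := closed_rel a && closed_rel (incr_pairs :\: a).

Definition assoc_rel (U : {set 'I_n}) a : bool :=
  [&& a \subset incr_pairs, trans_rel a &
   [forall i : 'I_n, forall j : 'I_n, forall k : 'I_n,
      [&& (i < j)%N, (j < k)%N & (i, k) \in a] ==>
      (if j \in U then (i, j) \in a else (j, k) \in a)]].

Lemma incrP a : reflect (forall i j, (i, j) \in a -> (i < j)%N)
  (a \subset incr_pairs).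
Proof.
apply: (iffP subsetP) => [h i j /h|h [i j] /h]; by rewrite inE.
Qed.

Lemma transP a :
  reflect (forall i j k, (i, j) \in a -> (j, k) \in a -> (i, k) \in a)
    (trans_rel a).
Proof.
apply: (iffP idP) => [/forallP h i j k ij jk|h].
  by have /forallP/(_ j)/forallP/(_ k) := h i; rewrite ij jk.
apply/forallP=> i; apply/forallP=> j; apply/forallP=> k.
by apply/implyP=> ij; apply/implyP; apply: h ij.
Qed.

Lemma assoc_relP U a :
  reflect [/\ a \subset incr_pairs, trans_rel a &
      forall i j k, (i < j)%N -> (j < k)%N -> (i, k) \in a ->
        if j \in U then (i, j) \in a else (j, k) \in a] (assoc_rel U a).
Proof.
apply: (iffP and3P) => -[aI aT h]; split=> //.
  move=> i j k ij jk ik.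
  by have /forallP/(_ i)/forallP/(_ j)/forallP/(_ k) := h; rewrite ij jk ik.
apply/forallP=> i; apply/forallP=> j; apply/forallP=> k.
by apply/implyP=> /and3P[]; apply: h.
Qed.

Lemma clopen_relP a :
  reflect [/\ a \subset incr_pairs, trans_rel a &
      forall i j k, (i < j)%N -> (j < k)%N -> (i, k) \in a ->
        (i, j) \in a \/ (j, k) \in a] (clopen_rel a).
Proof.
apply: (iffP andP) => [[/andP[aI aT] /andP[_ /transP h]]|[aI aT h]].
  split=> // i j k ij jk ik.
  case: (boolP ((i, j) \in a)) => [|ija]; first by left.
  case: (boolP ((j, k) \in a)) => [|jka]; first by right.
  by have := h i j k; rewrite !inE ija jka ij jk ik => /(_ isT isT).
split; apply/andP; split=> //; first exact: subsetDl.
apply/transP=> i j k; rewrite !inE /= => /andP[ija ij] /andP[jka jk].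
rewrite (ltn_trans ij jk) andbT; apply/negP=> ik.
by case: (h i j k ij jk ik) => [ija'|jka']; [move: ija; rewrite ija' | move: jka; rewrite jka'].
Qed.

Lemma assoc_clopen U a : assoc_rel U a -> clopen_rel a.
Proof.
case/assoc_relP=> aI aT h; apply/clopen_relP; split=> // i j k ij jk ik.
by have := h i j k ij jk ik; case: ifP; [left|right].
Qed.

Lemma clopenC a : clopen_rel a -> clopen_rel (incr_pairs :\: a).
Proof.
move=> /[dup] /andP[aC aO] /clopen_relP[aI _ _]; apply/andP; split=> //.
by rewrite setDDr setDv set0U (setIidPr aI).
Qed.

Lemma clopen0 : clopen_rel set0.
Proof.
apply/clopen_relP; split; first exact: sub0set.
  by apply/transP=> i j k; rewrite inE.
by move=> i j k _ _; rewrite inE.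
Qed.

Lemma clopen1 : clopen_rel incr_pairs.
Proof. by have := clopenC clopen0; rewrite setD0. Qed.

Definition trcl a : {set 'I_n * 'I_n} :=
  [set ij in incr_pairs | connect [rel i j | (i, j) \in a] ij.1 ij.2].

Lemma trclE a i j : (i, j) \in trcl a =
  (i < j)%N && connect [rel i j | (i, j) \in a] i j.
Proof. by rewrite !inE. Qed.

Lemma sub_trcl a : a \subset incr_pairs -> a \subset trcl a.
Proof.
move/incrP=> aI; apply/subsetP=> -[i j] ij; rewrite trclE aI //=.
exact: connect1.
Qed.

Lemma trcl_closed a : closed_rel (trcl a).
Proof.
apply/andP; split; first by apply/incrP=> i j; rewrite trclE => /andP[].
apply/transP=> i j k; rewrite !trclE => /andP[ij cij] /andP[jk cjk].
by rewrite (ltn_trans ij jk) (connect_trans cij cjk).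
Qed.

Lemma trcl_min a b : trans_rel b -> a \subset b -> trcl a \subset b.
Proof.
move=> /transP bT /subsetP ab; apply/subsetP=> -[i j]; rewrite trclE.
case/andP=> ij /connectP[[|m p] /= pi pj]; first by rewrite pj ltnn in ij.
rewrite {}pj {ij}; elim: p i m pi => [|m' p IH] i m /= /andP[/ab im pm] //.
exact: bT im (IH _ _ pm).
Qed.

Lemma trcl_between a j (P Q : bool) : P || Q ->
  (forall i k, (i < j)%N -> (j < k)%N -> (i, k) \in a ->
     P && ((i, j) \in a) || Q && ((j, k) \in a)) ->
  forall i k, (i < j)%N -> (j < k)%N -> (i, k) \in trcl a ->
     P && ((i, j) \in trcl a) || Q && ((j, k) \in trcl a).
Proof.
move=> PQ h i k ij jk; rewrite !trclE ij jk /= => /andP[_ /connectP[p pi pk]].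
elim: p i ij pi pk => [|m p IH] i ij /=.
  by move=> _ ki; have := ltn_trans ij jk; rewrite ki ltnn.
case/andP=> im pm pk.
have [mj|jm|jm] := ltngtP m j; first last.
- have {}jm : j = m by apply/val_inj.
  have mk : connect [rel i j | (i, j) \in a] m k by apply/connectP; exists p.
  by rewrite {1}jm (connect1 im) jm mk !andbT.
- have mk : connect [rel i j | (i, j) \in a] m k by apply/connectP; exists p.
  have /orP[/andP[-> ija]|/andP[-> jma]] := h _ _ ij jm im.
    by rewrite connect1.
  by rewrite (connect_trans (connect1 _) mk) ?orbT.
have /orP[/andP[-> mj']|/andP[-> ->]] := IH _ mj pm pk; last by rewrite orbT.
by rewrite (connect_trans (connect1 _) mj').
Qed.

Lemma trcl_assoc U a b :
  assoc_rel U a -> assoc_rel U b -> assoc_rel U (trcl (a :|: b)).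
Proof.
case/assoc_relP=> _ _ ha; case/assoc_relP=> _ _ hb.
have /andP[tI tT] := trcl_closed (a :|: b).
apply/assoc_relP; split=> // i j k ij jk ik.
have := @trcl_between (a :|: b) j (j \in U) (j \notin U) (orbN _) _ i k ij jk ik.
have ab i' k' : (i' < j)%N -> (j < k')%N -> (i', k') \in a :|: b ->
    (j \in U) && ((i', j) \in a :|: b) || (j \notin U) && ((j, k') \in a :|: b).
  move=> ij' jk'; rewrite !inE => /orP[/ha|/hb] /(_ _ ij' jk');
  by case: (j \in U) => /= ->; rewrite ?orbT.
by move/(_ ab); case: (j \in U); rewrite /= ?orbF.
Qed.

Lemma trcl_clopen a b :
  clopen_rel a -> clopen_rel b -> clopen_rel (trcl (a :|: b)).
Proof.
case/clopen_relP=> _ _ ha; case/clopen_relP=> _ _ hb.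
have /andP[tI tT] := trcl_closed (a :|: b).
apply/clopen_relP; split=> // i j k ij jk ik.
apply/orP; apply: (@trcl_between (a :|: b) j true true isT _ i k ij jk ik).
move=> i' k' ij' jk'; rewrite !inE.
by case/orP=> [/ha|/hb] /(_ _ ij' jk') [] ->; rewrite ?orbT.
Qed.

Lemma assoc_relI U a b :
  assoc_rel U a -> assoc_rel U b -> assoc_rel U (a :&: b).
Proof.
case/assoc_relP=> aI /transP aT ha; case/assoc_relP=> _ /transP bT hb.
apply/assoc_relP; split; first by rewrite subIset ?aI.
  apply/transP=> i j k; rewrite !inE => /andP[ija ijb] /andP[jka jkb].
  by rewrite (aT _ _ _ ija jka) (bT _ _ _ ijb jkb).
move=> i j k ij jk; rewrite !inE => /andP[/(ha _ _ _ ij jk) + /(hb _ _ _ ij jk)].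
by case: ifP => _ -> ->.
Qed.

Lemma assoc_rel0 U : assoc_rel U set0.
Proof.
apply/assoc_relP; split; first exact: sub0set.
  by apply/transP=> i j k; rewrite inE.
by move=> i j k _ _; rewrite inE.
Qed.

Lemma assoc_rel1 U : assoc_rel U incr_pairs.
Proof.
have /clopen_relP[iI iT _] := clopen1.
by apply/assoc_relP; split=> // i j k ij jk _; rewrite !inE ij jk; case: ifP.
Qed.

End Relations.

Fact permutohedron_display : Order.disp_t. Proof. exact: Order.Disp tt tt. Qed.

Record permutohedron (n : nat) := Permutohedron {
  perm_rel :> {set 'I_n * 'I_n};
  perm_relP : clopen_rel perm_rel
}.

HB.instance Definition _ n := [isSub for @perm_rel n].
HB.instance Definition _ n := [Finite of permutohedron n by <:].

Section PermutohedronLattice.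
Variable n : nat.
Implicit Types x y z : permutohedron n.

Let le x y := val x \subset val y.
Fact perm_le_refl : reflexive le. Proof. by move=> x; apply: subxx. Qed.
Fact perm_le_anti : antisymmetric le.
Proof. by move=> x y /andP[xy yx]; apply/val_inj/eqP; rewrite eqEsubset; apply/andP. Qed.
Fact perm_le_trans : transitive le.
Proof. by move=> y x z; apply: subset_trans. Qed.

HB.instance Definition _ := Order.Le_isPOrder.Build permutohedron_display
  (permutohedron n) perm_le_refl perm_le_anti perm_le_trans.

Lemma perm_leE x y : (x <= y) = (val x \subset val y). Proof. by []. Qed.

Definition perm_join x y : permutohedron n :=
  Permutohedron (trcl_clopen (perm_relP x) (perm_relP y)).
Definition perm_compl x : permutohedron n :=
  Permutohedron (clopenC (perm_relP x)).
Definition perm_meet x y := perm_compl (perm_join (perm_compl x) (perm_compl y)).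

Lemma perm_sub x : val x \subset incr_pairs n.
Proof. by case/clopen_relP: (perm_relP x). Qed.

Fact perm_joinP x y z : (perm_join x y <= z) = (x <= z) && (y <= z).
Proof.
rewrite !perm_leE -subUset; apply/idP/idP => [|xyz].
  by apply: subset_trans; apply: sub_trcl; rewrite subUset !perm_sub.
by apply: trcl_min xyz; case/clopen_relP: (perm_relP z).
Qed.

Lemma perm_complK : involutive perm_compl.
Proof.
move=> x; apply/val_inj; rewrite /= setDDr setDv set0U.
by apply/setIidPr/perm_sub.
Qed.

Lemma perm_compl_le x y : (perm_compl x <= perm_compl y) = (y <= x).
Proof.
have h u v : u <= v -> perm_compl v <= perm_compl u.
  by rewrite !perm_leE /= => uv; apply: setDS.
by apply/idP/idP => [/h|/h //]; rewrite !perm_complK.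
Qed.

Fact perm_meetP x y z : (x <= perm_meet y z) = (x <= y) && (x <= z).
Proof.
rewrite -(perm_complK x) perm_compl_le perm_joinP.
by rewrite -(perm_complK y) -(perm_complK z) !perm_compl_le !perm_complK.
Qed.

HB.instance Definition _ := Order.POrder_MeetJoin_isLattice.Build
  permutohedron_display (permutohedron n) perm_meetP perm_joinP.

Fact perm_le0x x : Permutohedron (clopen0 n) <= x.
Proof. by rewrite perm_leE sub0set. Qed.
Fact perm_lex1 x : x <= Permutohedron (clopen1 n).
Proof. by rewrite perm_leE perm_sub. Qed.

HB.instance Definition _ := Order.hasBottom.Build
  permutohedron_display (permutohedron n) perm_le0x.
HB.instance Definition _ := Order.hasTop.Build
  permutohedron_display (permutohedron n) perm_lex1.

Lemma perm_joinE x y : val (x `|` y) = trcl (val x :|: val y).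
Proof. by []. Qed.

End PermutohedronLattice.

(* A_U(n) as a subset of P(n); by [assoc_clopen] no member is lost by ranging
   over clopen sets only. *)
Definition assoc_set n (U : {set 'I_n}) : {pred permutohedron n} :=
  fun x => assoc_rel U (val x).

Section AssocClosed.
Variables (n : nat) (U : {set 'I_n}).
Local Notation A := (@assoc_set n U).
Implicit Types x y : permutohedron n.

Lemma val_meet_assoc : {in A &, forall x y, val (x `&` y) = val x :&: val y}.
Proof.
move=> x y xA yA; apply/eqP; rewrite eqEsubset subsetI.
rewrite -!perm_leE leIl leIr /=.
pose z := Permutohedron (assoc_clopen (assoc_relI xA yA)).
have : z <= x `&` y by rewrite lexI !perm_leE /= subsetIl subsetIr.
by [].
Qed.

Fact assoc_opredI : {in A &, forall x y, x `&` y \in A}.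
Proof.
by move=> x y xA yA; rewrite unfold_in /assoc_set val_meet_assoc //; apply: assoc_relI.
Qed.
Fact assoc_opredU : {in A &, forall x y, x `|` y \in A}.
Proof. by move=> x y; apply: trcl_assoc. Qed.
Fact assoc_opred0 : \bot \in A. Proof. exact: assoc_rel0. Qed.
Fact assoc_opred1 : \top \in A. Proof. exact: assoc_rel1. Qed.

HB.instance Definition _ := Order.isTBLatticeClosed.Build _ _ A
  assoc_opredI assoc_opredU assoc_opred0 assoc_opred1.

End AssocClosed.

Record assocLattice (n : nat) (U : {set 'I_n}) := Assoc {
  assoc_perm :> permutohedron n;
  assoc_permP : assoc_perm \in assoc_set U
}.

HB.instance Definition _ n U := [isSub for @assoc_perm n U].
HB.instance Definition _ n U := [Finite of @assocLattice n U by <:].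
HB.instance Definition _ n U :=
  [SubChoice_isTBSubLattice of @assocLattice n U by <: with permutohedron_display].

Lemma assoc_leE n (U : {set 'I_n}) (x y : assocLattice U) :
  (x <= y) = (perm_rel x \subset perm_rel y).
Proof. by []. Qed.

(* Main.v *)
Require Import Defs.
From HB Require Import structures.
From mathcomp Require Import all_boot all_order.
From mathcomp Require Import zify.
Set Implicit Arguments.
Unset Strict Implicit.
Unset Printing Implicit Defensive.
Import Order.TTheory.

(** Let [<a,b>] be the least member of A_U(n) containing [(a, b)].  The largest
    member of A_U(n) below a clopen set [x] is
    [core x = {(a, b) | <a,b> is contained in x}], so [core] is right adjoint to
    the inclusion and preserves meets; the point is that it preserves joins.
    Suppose that [<a,b>] lies in [z = x \/ y], and that no [c] strictly between
    [a] and [b] has both [<a,c>] and [<c,b>] contained in [z].  As [z] is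
    co-transitive, this forces [(c, b)] out of [z] for [c] in [U] and [(a, c)]
    out of [z] for [c] not in [U].  Hence [(a, b)] already belongs to [x] or to
    [y], and that set then contains all of [<a,b>].  Induction on [b - a]
    handles the other case.

    Join-fitness follows: if [p] in A_U(n) lies below [q \/ x], then it lies
    below [core q \/ x], which is impossible for [p D q] if [core q < q]. *)

(** * Cores of relations and how they meet transitive closure *)

Section Core.
Variables (n : nat) (U : {set 'I_n}).
Implicit Types (a b c i j k : 'I_n) (x y z s : {set 'I_n * 'I_n}).

(** The set [<a,b>]: membership of [(a, b)] forces [(i, b)] for [i] outside [U], and this in turn
    forces [(i, j)] for [j] in [U]. *)
Definition block a b : {set 'I_n * 'I_n} :=
  [set ij : 'I_n * 'I_n | [&& a <= ij.1, ij.1 < ij.2, ij.2 <= b,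
     (ij.1 == a) || (ij.1 \notin U) & (ij.2 == b) || (ij.2 \in U)]].

(** A block with [b <= a] is empty, so such pairs are kept out by [incr_pairs]. *)
Definition core x : {set 'I_n * 'I_n} :=
  [set ab in incr_pairs n | block ab.1 ab.2 \subset x].

Lemma blockP a b x :
  reflect (forall i j, a <= i -> i < j -> j <= b -> (i == a) || (i \notin U) ->
             (j == b) || (j \in U) -> (i, j) \in x)
          (block a b \subset x).
Proof.
apply: (iffP subsetP) => [h i j ai ij jb iU jU|h [i j]].
  by apply: h; rewrite inE /= ai ij jb iU.
by rewrite inE /= => /and5P[]; apply: h.
Qed.

Lemma coreP x a b :
  reflect (a < b /\ block a b \subset x) ((a, b) \in core x).
Proof. by rewrite !inE; apply: andP. Qed.

Lemma core_sub x : core x \subset x.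
Proof.
apply/subsetP=> -[a b] /coreP[ab /blockP]; apply=> //; by rewrite eqxx.
Qed.

Lemma coreS x y : x \subset y -> core x \subset core y.
Proof.
move=> xy; apply/subsetP=> -[a b] /coreP[ab abx]; apply/coreP.
by split=> //; apply: subset_trans xy.
Qed.

Lemma sub_core s x : assoc_rel U s -> s \subset x -> s \subset core x.
Proof.
case/assoc_relP=> /incrP sI sT sU sx; apply/subsetP=> -[a b] ab.
apply/coreP; split; first exact: sI.
apply/blockP=> i j ai ij jb iU jU; apply: (subsetP sx).
have ib : (i, b) \in s.
  case/orP: iU => [/eqP-> //|iU].
  have [ia|ia] := eqVneq i a; first by rewrite ia.
  rewrite -val_eqE /= in ia.
  by have := sU a i b; rewrite (negPf iU); apply=> //; lia.
case/orP: jU => [/eqP-> //|jU].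
have [jb'|jb'] := eqVneq j b; first by rewrite jb'.
rewrite -val_eqE /= in jb'.
by have := sU i j b; rewrite jU; apply=> //; lia.
Qed.

Lemma core_assoc x : trans_rel x -> assoc_rel U (core x).
Proof.
move=> /transP xT; apply/assoc_relP; split.
- by apply/incrP=> a b /coreP[].
- apply/transP=> a b c /coreP[ab /blockP abx] /coreP[bc /blockP bcx].
  apply/coreP; split; first exact: ltn_trans bc.
  apply/blockP=> i j ai ij jc iU jU.
  (* A pair straddling [b] is composed of [(i, b)] and [(b, j)], since [b] is an allowed end of both
     smaller blocks; any other pair lies in one of them. *)
  have [jb|bj] := leqP j b.
    by apply: abx => //; apply/orP; right; case/orP: jU => // /eqP jc'; rewrite jc' in jb; lia.
  have [bi|ib] := leqP b i.
    by apply: bcx => //; apply/orP; right; case/orP: iU => // /eqP ia; rewrite ia in bi; lia.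
  by apply: (xT _ b); [apply: abx | apply: bcx]; rewrite ?eqxx // ltnW.
- move=> a b c ab bc /coreP[ac /blockP acx]; case: ifP => bU; apply/coreP.
    split=> //; apply/blockP=> i j ai ij jb iU jU; apply: acx => //; first lia.
    by case/orP: jU => [/eqP->|->]; rewrite ?bU orbT.
  split=> //; apply/blockP=> i j bi ij jc iU jU; apply: acx => //; first lia.
  by case/orP: iU => [/eqP->|->]; rewrite ?bU orbT.
Qed.

Lemma trcl_first x a b : x \subset incr_pairs n -> (a, b) \in trcl x ->
  (a, b) \in x \/
  exists c, [/\ a < c, c < b, (a, c) \in trcl x & (c, b) \in trcl x].
Proof.
move=> xI; rewrite trclE => /andP[ab /connectP[[|c p] /=]].
  by move=> _ ba; rewrite ba ltnn in ab.
case/andP=> ac pc bp; have [<-|cb] := eqVneq c b; first by left.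
right; exists c; have cb' : connect [rel i j | (i, j) \in x] c b.
  by apply/connectP; exists p.
have {}cb : c < b.
  have : c <= b.
    rewrite {}bp {cb cb' ac}; elim: p c pc => //= m p IH c /andP[cm mp].
    by have := incrP _ xI _ _ cm; have := IH _ mp; lia.
  by rewrite leq_eqVlt => /predU1P[/val_inj cb'2|//]; rewrite cb'2 eqxx in cb.
rewrite !trclE cb cb' (incrP _ xI _ _ ac); split=> //.
exact: connect1.
Qed.

Lemma block_split z a b :
  clopen_rel z -> block a b \subset z ->
  (exists c, [/\ a < c, c < b, block a c \subset z & block c b \subset z]) \/
  forall c, a < c -> c < b ->
    if c \in U then (c, b) \notin z else (a, c) \notin z.
Proof.
case/clopen_relP=> _ _ zO /blockP abz.
case: (boolP [exists c : 'I_n, [&& a < c, c < b, block a c \subset z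
                                & block c b \subset z]]) => [|/existsPn nsplit].
  by case/existsP=> c /and4P[*]; left; exists c.
right=> c ac cb; case: ifP => cU; apply/negP.
- (* An element [c] of [U] with [(c, b)] in [z] and [b - c] least splits. *)
  have [m] := ubnP (b - c); elim: m c ac cb cU => // m IH c ac cb cU cm cbz.
  have /negP := nsplit c; apply; rewrite ac cb /=; apply/andP; split.
    apply/blockP=> i j ai ij jc iU jU; apply: abz => //; first lia.
    by case/orP: jU => [/eqP->|->]; rewrite ?cU orbT.
  apply/blockP=> i j ci ij jb iU jU.
  (* Pairs with left end other than [c] lie in [block a b]. For [(c, j)], the alternative left by
     co-transitivity is [(j, b)], excluded because [j] is closer to [b]. *)
  have [ic|ic] := eqVneq i c; last first.
    by apply: abz => //; [lia | move: iU; rewrite (negPf ic) /= orbC => ->].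
  rewrite {}ic in ij *.
  have [->//|jb'] := eqVneq j b.
  rewrite (negPf jb') /= in jU.
  have {}jb' : j < b by rewrite ltn_neqAle jb'.
  case: (zO _ _ _ ij jb' cbz) => // jbz.
  by exfalso; apply: (IH j) => //; lia.
(* Dually, for [c] outside [U], take [(a, c)] in [z] with [c - a] least. *)
- have [m] := ubnP (c - a); elim: m c ac cb cU => // m IH c ac cb cU cm acz.
  have /negP := nsplit c; apply; rewrite ac cb /=; apply/andP; split; last first.
    apply/blockP=> i j ci ij jb iU jU; apply: abz => //; first lia.
    by case/orP: iU => [/eqP->|->]; rewrite ?cU orbT.
  apply/blockP=> i j ai ij jc iU jU.
  have [jc'|jc'] := eqVneq j c; last first.
    by apply: abz => //; [lia | move: jU; rewrite (negPf jc') /= orbC => ->].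
  rewrite {}jc' in ij *.
  have [->//|ia'] := eqVneq i a.
  rewrite (negPf ia') /= in iU.
  have {}ia' : a < i by rewrite ltn_neqAle eq_sym ia'.
  case: (zO _ _ _ ia' ij acz) => // aiz.
  by exfalso; apply: (IH i) => //; [lia | apply: negbTE | lia].
Qed.

(** Co-transitivity of [x] is used twice: first [(a, i)] is excluded for [i] outside [U], leaving
    [(i, b)]; then [(j, b)] is excluded for [j] in [U], leaving [(i, j)]. *)
Lemma block_sub_clopen x z a b :
  clopen_rel x -> x \subset z -> (a, b) \in x ->
  (forall c, a < c -> c < b ->
     if c \in U then (c, b) \notin z else (a, c) \notin z) ->
  block a b \subset x.
Proof.
case/clopen_relP=> _ _ xO /subsetP xz abx h; apply/blockP=> i j ai ij jb iU jU.
have notx c d : (c, d) \notin z -> (c, d) \notin x by apply: contra; apply: xz.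
have ibx : (i, b) \in x.
  have [->//|ia] := eqVneq i a.
  rewrite (negPf ia) /= in iU.
  have ai' : a < i by rewrite ltn_neqAle eq_sym ia.
  have ib : i < b by lia.
  have := h _ ai' ib; rewrite (negPf iU) => /notx aix.
  by case: (xO _ _ _ ai' ib abx) => //; rewrite (negPf aix).
have [->//|jb'] := eqVneq j b.
rewrite (negPf jb') /= in jU.
have aj : a < j by lia.
have {}jb' : j < b by rewrite ltn_neqAle jb'.
have := h _ aj jb'; rewrite jU => /notx jbx.
by case: (xO _ _ _ ij jb' ibx) => //; rewrite (negPf jbx).
Qed.

Lemma core_join x y : clopen_rel x -> clopen_rel y ->
  core (trcl (x :|: y)) \subset trcl (core x :|: core y).
Proof.
move=> xC yC; have zC := trcl_clopen xC yC; set z := trcl (x :|: y) in zC *.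
have xyI : x :|: y \subset incr_pairs n.
  by rewrite subUset; case/clopen_relP: xC => ->; case/clopen_relP: yC => ->.
have /subsetP xyz := sub_trcl xyI.
have /andP[_ /transP cT] := trcl_closed (core x :|: core y).
have /subsetP sub_c : core x :|: core y \subset trcl (core x :|: core y).
  apply: sub_trcl; apply/incrP=> a b.
  by rewrite inE => /orP[] /coreP[].
apply/subsetP=> -[a b] /coreP[ab abz].
have [m] := ubnP (b - a); elim: m a b ab abz => // m IH a b ab abz bam.
have [[c [ac cb acz cbz]]|h] := block_split zC abz.
  by apply: (cT _ c); apply: IH => //; lia.
have abz' : (a, b) \in z by apply: (blockP _ _ _ abz); rewrite ?eqxx.
(* A path with an inner vertex [c] would put both [(a, c)] and [(c, b)] in [z], and [h] excludes one
   of them. *)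
apply: sub_c; have [|[c [ac cb acz cbz]]] := trcl_first xyI abz'; last first.
  by have := h c ac cb; rewrite acz cbz; case: ifP.
rewrite !inE ab /= => /orP[abx|aby]; apply/orP; [left|right].
  by apply: block_sub_clopen h => //; apply/subsetP=> u ux; apply: xyz; rewrite inE ux.
by apply: block_sub_clopen h => //; apply/subsetP=> u uy; apply: xyz; rewrite inE uy orbT.
Qed.

End Core.

Local Open Scope order_scope.

(** * The retraction of P(n) onto A_U(n) *)

Section Retraction.
Variables (n : nat) (U : {set 'I_n}).
Implicit Types (x y : permutohedron n) (k : assocLattice U).

Lemma perm_core_assoc x : assoc_rel U (core U (val x)).
Proof. by apply: core_assoc; case/clopen_relP: (perm_relP x). Qed.

Definition perm_core x : assocLattice U :=
  @Assoc n U (Permutohedron (assoc_clopen (perm_core_assoc x)))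
    (perm_core_assoc x).

Lemma perm_core_le x : val (perm_core x) <= x.
Proof. exact: core_sub. Qed.

(** This adjunction yields meets, monotonicity and the retraction identity formally; only joins need
    [core_join]. *)
Lemma le_perm_core k x : (k <= perm_core x) = (val k <= x).
Proof.
apply/idP/idP => [kx|]; first exact: le_trans (perm_core_le x).
by apply: sub_core; apply: assoc_permP.
Qed.

Lemma perm_coreK : cancel val perm_core.
Proof.
move=> k; apply: le_anti; rewrite le_perm_core lexx andbT.
exact: perm_core_le.
Qed.

Fact perm_core_meet : {morph perm_core : x y / x `&` y}.
Proof.
move=> x y; apply: le_anti; apply/andP; split.
  by rewrite lexI !le_perm_core -lexI; apply: perm_core_le.
rewrite le_perm_core lexI -!le_perm_core.
by rewrite leIl leIr.
Qed.

Fact perm_core_join : {morph perm_core : x y / x `|` y}.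
Proof.
move=> x y; apply: le_anti; apply/andP; split.
  exact: core_join (perm_relP x) (perm_relP y).
rewrite leUx !le_perm_core.
by rewrite (le_trans (perm_core_le x) (leUl _ _)) (le_trans (perm_core_le y) (leUr _ _)).
Qed.

Fact perm_core_homo : {homo perm_core : x y / x <= y}.
Proof. by move=> x y xy; rewrite le_perm_core (le_trans (perm_core_le x)). Qed.

HB.instance Definition _ := Order.isOrderMorphism.Build _ _ _ _ perm_core perm_core_homo.
HB.instance Definition _ := Order.isMeetLatticeMorphism.Build _ _ _ _ perm_core perm_core_meet.
HB.instance Definition _ := Order.isJoinLatticeMorphism.Build _ _ _ _ perm_core perm_core_join.

(** A named copy of [val], to carry the morphism instances of the inclusion. *)
Definition assoc_val : assocLattice U -> permutohedron n := val.

HB.instance Definition _ := Order.isOrderMorphism.Build _ _ _ _ assoc_val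
  (fun _ _ => id).
HB.instance Definition _ := Order.isMeetLatticeMorphism.Build _ _ _ _ assoc_val
  (fun _ _ => erefl).
HB.instance Definition _ := Order.isJoinLatticeMorphism.Build _ _ _ _ assoc_val
  (fun _ _ => erefl).

Lemma assoc_retract : lattice_retract (assocLattice U) (permutohedron n).
Proof. by exists assoc_val, perm_core; apply: perm_coreK. Qed.

End Retraction.

(** * Join-fitness *)

Lemma lt_Ji_lower_star d (L : finTBLatticeType d) (r q : L) :
  q \in Ji predT -> r < q -> r <= lower_star q.
Proof.
(* [Ji_lower_cover] speaks of covers only, so climb from [r] towards [q], by induction on the number
   of elements strictly between. *)
move=> qJ rq; have [m] := ubnP #|[set t : L | r < t & t < q]|.
elim: m r rq => // m IH r rq rm.
case: (boolP (lower_cover r q)) => [|].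
  by rewrite Ji_lower_cover // => /eqP->.
rewrite /lower_cover rq /= => /forallPn[t /negPn/andP[rt tq]].
apply: le_trans (ltW rt) (IH t tq _).
apply: leq_trans (rm : (_ <= m)%N); apply: proper_card; apply/properP; split.
  by apply/subsetP=> u; rewrite !inE => /andP[/(lt_trans rt)-> ->].
by exists t; rewrite inE ?rt ?tq // ltxx.
Qed.

Lemma assoc_join_fits n (U : {set 'I_n}) : join_fits (assoc_set U).
Proof.
split; first by split; [apply: assoc_opred0 | apply: assoc_opred1 | apply: assoc_opredU].
move=> p q /andP[pA _] qJ [_ _ [x [pqx /negP npqx]]].
have := perm_core_le U q; rewrite le_eqVlt => /predU1P[<-|]; first exact: assoc_permP.
move=> /(lt_Ji_lower_star qJ) cq; case: npqx.
(* By adjunction [p] lies below the join of the cores of [q] and [x], hence below that of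
   [lower_star q] and [x]. *)
have := pqx; rewrite -[p]/(val (Assoc pA)) -le_perm_core perm_core_join => pc.
apply: le_trans (leU2 cq (perm_core_le U x)).
exact: pc.
Qed.

Theorem proposition6p4 (n : nat) (U : {set 'I_n}) (hn : (0 < n)%N) :
  join_fits (assoc_set U) /\ lattice_retract (assocLattice U) (permutohedron n).
Proof. by split; [apply: assoc_join_fits | apply: assoc_retract]. Qed.
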